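(* Let $\mathcal{C}$ be the family of all centipedes. A graph $G$ admits a full $\mathcal{C}$-colouring if and only if $G$ contains none of the following as an induced subgraph: a cycle of length different from $4$, the graph $A$, the graph $B$, the graph $T_2$.
   Context: Graphs are finite and undirected, with neither loops nor parallel edges. A full homomorphism from $G$ to $H$ is a function $\varphi\colon V_G\to V_H$ such that, for all $u,v\in V_G$, $uv\in E_G$ if and only if $\varphi(u)\varphi(v)\in E_H$. A graph admits a full $\mathcal{C}$-colouring if it admits a full homomorphism to some graph in $\mathcal{C}$. For $k\ge 1$, the $k$-centipede is the tree on $2k$ vertices obtained from a path on $k$ vertices (the spine) by attaching exactly one leaf to every vertex of the path (so the $1$-centipede is the path on two vertices); a centipede is a $k$-centipede for some $k\ge1$. $A$ is the graph obtained from a 4-cycle $u_1u_2u_3u_4u_1$ by adding two nonadjacent vertices $v,w$, with $v$ adjacent only to $u_1$ and $w$ only to $u_2$; $B$ is obtained from $A$ by adding the edge $vw$. $T_2$ is the tree obtained from $K_{1,3}$ by subdividing each edge once. *)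

(* Defs.v *)
From mathcomp Require Import all_boot.
Set Implicit Arguments.
Unset Strict Implicit.
Unset Printing Implicit Defensive.

Record sgraph := SGraph {
  vertex :> finType;
  edge : rel vertex;
  edge_sym : symmetric edge;
  edge_irr : irreflexive edge }.
Arguments edge {s}.

Definition full_hom (G H : sgraph) (phi : G -> H) : Prop :=
  forall u v : G, edge u v = edge (phi u) (phi v).

Definition full_colourable (C : sgraph -> Prop) (G : sgraph) : Prop :=
  exists2 H : sgraph, C H & exists phi : G -> H, full_hom phi.

Definition isomorphic (G H : sgraph) : Prop :=
  exists2 phi : G -> H, bijective phi & full_hom phi.

Section Induced.
Variables (G : sgraph) (S : {set G}).
Let T : finType := {x : G | x \in S}.
Let e : rel T := fun x y => edge (val x) (val y).
Let e_sym : symmetric e. Proof. by move=> x y; apply: edge_sym. Qed.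
Let e_irr : irreflexive e. Proof. by move=> x; apply: edge_irr. Qed.
Definition induced : sgraph := SGraph e_sym e_irr.
End Induced.

Definition has_induced (G H : sgraph) : Prop :=
  exists S : {set G}, isomorphic (induced S) H.

(* The simple graph generated by an arbitrary relation: r is symmetrised and
   its loops are dropped, so each edge needs to be listed in one direction
   only. *)
Section GraphOf.
Variables (T : finType) (r : rel T).
Let e : rel T := fun x y => (x != y) && (r x y || r y x).
Let e_sym : symmetric e. Proof. by move=> x y; rewrite /e eq_sym orbC. Qed.
Let e_irr : irreflexive e. Proof. by move=> x; rewrite /e eqxx. Qed.
Definition graph_of : sgraph := SGraph e_sym e_irr.
End GraphOf.

Definition graph_of_edges (n : nat) (s : seq (nat * nat)) : sgraph :=
  graph_of (fun i j : 'I_n => (val i, val j) \in s).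

(* This is the n-cycle only for n >= 3. *)
Definition cycle_graph (n : nat) : sgraph :=
  graph_of (fun i j : 'I_n => val j == i.+1 %% n).

(* inl i is the i-th vertex of the spine, inr i the leaf attached to it. *)
Definition centipede (k : nat) : sgraph :=
  graph_of (fun x y : 'I_k + 'I_k =>
    match x, y with
    | inl i, inl j => val j == i.+1
    | inl i, inr j => i == j
    | _, _ => false
    end).

Definition is_centipede (H : sgraph) : Prop :=
  exists2 k : nat, 1 <= k & isomorphic H (centipede k).

(* u_1, u_2, u_3, u_4, v, w are numbered 0, 1, 2, 3, 4, 5. *)
Definition graphA_edges : seq (nat * nat) :=
  [:: (0, 1); (1, 2); (2, 3); (3, 0); (4, 0); (5, 1)].
Definition graphA : sgraph := graph_of_edges 6 graphA_edges.
Definition graphB : sgraph := graph_of_edges 6 ((4, 5) :: graphA_edges).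

(* K_{1,3} has centre 0 and leaves 4, 5, 6; the subdivision vertices are
   1, 2, 3. *)
Definition graphT2 : sgraph :=
  graph_of_edges 7 [:: (0, 1); (0, 2); (0, 3); (1, 4); (2, 5); (3, 6)].

(* Main.v *)
Require Import Defs.
From mathcomp Require Import all_boot.
From mathcomp Require Import zify.
Set Implicit Arguments.
Unset Strict Implicit.
Unset Printing Implicit Defensive.

(** A graph is twin-free when distinct vertices have distinct neighbourhoods.
    Both directions rest on the fact that a full homomorphism out of a
    twin-free graph is injective, since vertices with the same image have the
    same neighbours.

    Necessity.  Every forbidden graph is twin-free.  If one were induced in a
    graph mapping to a centipede, it would therefore embed injectively in the
    centipede, keeping edges and non-edges.  The cycles, A and B contain a
    nonempty set of vertices each having two neighbours in that set; the leaves
    of a centipede have degree 1, so such a set lands in the spine, and its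
    vertex furthest along the spine has only one place for its two neighbours
    ([centipede_no_min_degree2]).  In T_2 the centre and its three neighbours
    have degree at least 2, so they would all be on the spine, where a vertex
    has at most two neighbours.

    Sufficiency.  Choosing one vertex in each class of twins gives an induced
    subgraph Q of G, and G maps to Q by a full homomorphism; so it is enough to
    colour Q, which is twin-free.  A 4-cycle in Q would have, for each of its
    two pairs of opposite vertices, a vertex separating the pair, and these two
    vertices complete the 4-cycle to an induced A or B ([no_square]).  Hence Q
    has no induced cycle at all.  As Q has neither triangles, nor 4-cycles, nor
    5-cycles, any vertex with three neighbours of degree at least 2 gives an
    induced T_2 ([no_subdivided_claw]).  So every vertex of degree at least 2
    has at most two neighbours of degree at least 2.

    Let the spine S consist of the vertices of degree at least 2 and of one end
    of each component with two vertices.  Then the subgraph induced by S has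
    maximum degree at most 2 and no induced cycles, so it is a disjoint union
    of paths, and it can be laid out on the integers with a gap between
    consecutive paths ([linear_forest]).  A vertex outside S has at most one
    neighbour, which is in S; it is sent to the leaf at the place of that
    neighbour, and isolated vertices are sent to a leaf far away
    ([centipede_colouring]). *)

(** * Full homomorphisms and induced subgraphs *)

Lemma edgeC (G : sgraph) (x y : G) : edge x y -> edge y x.
Proof. by rewrite edge_sym. Qed.

Lemma edge_neq (G : sgraph) (x y : G) : edge x y -> x != y.
Proof. by move=> xy; apply: contraTneq xy => ->; rewrite edge_irr. Qed.

Lemma full_hom_comp (G H K : sgraph) (f : G -> H) (g : H -> K) :
  full_hom f -> full_hom g -> full_hom (g \o f).
Proof. by move=> hf hg u v; rewrite hf hg. Qed.

(** Working with an injective map of [H] into [G], rather than with a subset of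
    [G] and an isomorphism onto [H], is what makes induced subgraphs compose. *)
Lemma has_inducedP (G H : sgraph) :
  has_induced G H <-> exists2 h : H -> G, injective h & full_hom h.
Proof.
split=> [[S [f [g fK gK] hf]] | [h h_inj hh]].
  exists (val \o g) => [|u v]; first exact: inj_comp val_inj (can_inj gK).
  by rewrite -[LHS](congr2 edge (gK u) (gK v)) -hf.
pose S := [set x in codom h].
have hS y : h y \in S by rewrite inE codom_f.
pose h' y : induced S := Sub (h y) (hS y).
have h'_inj : injective h' by move=> y z /(congr1 val) /h_inj.
have card_S : #|induced S| = #|H|.
  rewrite /induced /= card_sig -(card_codom h_inj).
  by apply: eq_card => x; rewrite !inE.
have [g gK h'K] : bijective h' by apply: inj_card_bij; rewrite ?card_S.
exists S; exists g; first by exists h'.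
by move=> u v; rewrite -{1}[u]h'K -{1}[v]h'K [RHS]hh.
Qed.

Definition twin_free (G : sgraph) : Prop :=
  forall x y : G, (forall z, edge x z = edge y z) -> x = y.

(** Vertices with the same image under a full homomorphism are twins. *)
Lemma twin_free_full_hom_inj (H G : sgraph) (h : H -> G) :
  twin_free H -> full_hom h -> injective h.
Proof. by move=> H_tf hh x y exy; apply: H_tf => z; rewrite !hh exy. Qed.

(** * Centipedes *)

Lemma centipede_colourableP (G : sgraph) :
  full_colourable is_centipede G <->
  exists2 k, 1 <= k & exists phi : G -> centipede k, full_hom phi.
Proof.
split=> [[H [k k_gt0 [f _ hf]] [phi hphi]] | [k k_gt0 [phi hphi]]].
  by exists k => //; exists (f \o phi); apply: full_hom_comp hphi hf.
exists (centipede k); last by exists phi.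
by exists k => //; exists id => //; exists id.
Qed.

Lemma centipede_edgeE k (x y : centipede k) :
  edge x y = match x, y with
             | inl i, inl j => (val j == i.+1) || (val i == j.+1)
             | inl i, inr j => i == j
             | inr i, inl j => i == j
             | inr _, inr _ => false
             end.
Proof.
case: x y => [i|i] [j|j]; rewrite /edge /=.
- rewrite -[inl i == inl j]/(i == j); case: eqVneq => [->|//] /=.
  by rewrite orbb ltn_eqF.
- by rewrite orbF.
- by rewrite eq_sym.
- by rewrite andbF.
Qed.

(** A leaf of a centipede has only one neighbour. *)
Lemma branching_in_spine k (x a b : centipede k) :
  edge x a -> edge x b -> a != b -> exists i, x = inl i.
Proof.
case: x => [i|i]; first by exists i.
by rewrite !centipede_edgeE; case: a b => [a|//] [b|//] /eqP-> /eqP->; rewrite eqxx.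
Qed.

(** By degree, such a set [S] is mapped into the spine.  Its member furthest along
    the spine has all its neighbours of [S] just one step before it, so the
    injectivity of [phi] leaves room for only one. *)
Lemma centipede_no_min_degree2 k (H : sgraph) (phi : H -> centipede k)
    (S : {set H}) x0 :
  full_hom phi -> injective phi -> x0 \in S ->
  (forall x, x \in S ->
     exists a b, [/\ a \in S, b \in S, a != b, edge x a & edge x b]) ->
  False.
Proof.
move=> hphi phi_inj x0S core.
have spine x : x \in S -> exists i, phi x = inl i.
  move=> /core[a [b [aS bS nab xa xb]]].
  by apply: (@branching_in_spine _ _ (phi a) (phi b)); rewrite -?hphi // inj_eq.
pose pos (v : centipede k) : nat := match v with inl i => i | inr i => i end.
case: (@arg_maxnP _ x0 (mem S) (pos \o phi) x0S) => x xS x_max.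
have [i ei] := spine x xS.
have below c : c \in S -> edge x c ->
    exists2 j : 'I_k, phi c = inl j & i = j.+1 :> nat.
  move=> cS xc; have [j ej] := spine c cS; exists j => //.
  move: xc (x_max c cS); rewrite hphi centipede_edgeE /= ei ej /=.
  case/orP=> /eqP -> //.
  by rewrite ltnn.
have [a [b [aS bS nab xa xb]]] := core x xS.
have [ja eja ia] := below a aS xa; have [jb ejb ib] := below b bS xb.
case/eqP: nab; apply: phi_inj; rewrite eja ejb; congr inl; apply: val_inj => /=; lia.
Qed.

(** * The forbidden graphs have no full homomorphism to a centipede *)

Lemma ordS_cases n (i : 'I_n) :
  i.+1 = n /\ ordS i = 0 :> nat \/ i.+1 < n /\ ordS i = i.+1 :> nat.
Proof.
have := ltn_ord i; rewrite leq_eqVlt => /orP[/eqP ei | lt_i]; [left|right].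
  by split; rewrite //= ei modnn.
by split; rewrite //= modn_small.
Qed.

Lemma cycle_edgeE n (i j : cycle_graph n) : 3 <= n ->
  edge i j = (j == ordS i :> 'I_n) || (i == ordS j :> 'I_n).
Proof.
move=> n_gt2.
rewrite -[LHS]/((i != j) && ((j == ordS i :> 'I_n) || (i == ordS j :> 'I_n))).
case: eqVneq => //= ->; rewrite orbb.
apply/esym/negbTE/eqP => /(congr1 (@nat_of_ord n)).
by case: (ordS_cases j); lia.
Qed.

(** If [i] and [j] are distinct twins, then [i.+1] is a neighbour of [j] and
    [j.+1] is a neighbour of [i], which forces [i] and [j] to be two steps apart
    in both directions, that is, [n = 4]. *)
Lemma cycle_twin_free n : 3 <= n -> n <> 4 -> twin_free (cycle_graph n).
Proof.
move=> n_gt2 n_neq4 i j tw; have := tw (ordS i); have := tw (ordS j).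
rewrite !cycle_edgeE // !eqxx /= => /orP ej /esym/orP ei.
apply: val_inj; case: ei ej.
all: move=> /eqP/(congr1 (@nat_of_ord n)) ei [] /eqP/(congr1 (@nat_of_ord n)) ej.
all: move: ei ej (ordS_cases i) (ordS_cases j).
all: move: (ordS_cases (ordS i)) (ordS_cases (ordS j)).
all: rewrite /=; lia.
Qed.

Lemma cycle_min_degree n (i : cycle_graph n) : 3 <= n ->
  exists a b, [/\ a != b, edge i a & edge i b].
Proof.
move=> n_gt2; exists (ordS i), (ord_pred i).
rewrite !cycle_edgeE // eqxx ord_predK eqxx orbT; split=> //.
apply/eqP => /(congr1 (@ordS n)); rewrite ord_predK => /(congr1 (@nat_of_ord n)).
by case: (ordS_cases i) (ordS_cases (ordS i)); lia.
Qed.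

Lemma cycle_not_centipede n k (phi : cycle_graph n -> centipede k) :
  3 <= n -> n <> 4 -> ~ full_hom phi.
Proof.
move=> n_gt2 n_neq4 hphi.
have n_gt0 : 0 < n by lia.
pose x0 : cycle_graph n := Ordinal n_gt0.
have phi_inj := twin_free_full_hom_inj (cycle_twin_free n_gt2 n_neq4) hphi.
apply: (centipede_no_min_degree2 (S := setT) (x0 := x0) hphi phi_inj).
  by rewrite inE.
move=> i _; have [a [b [nab ia ib]]] := cycle_min_degree i n_gt2.
by exists a, b; rewrite !inE.
Qed.

(** Adjacency is tested here on natural numbers, so that the check is carried
    out by computation. *)
Definition edges_twin_free n (s : seq (nat * nat)) : bool :=
  let adj i j := (i != j) && (((i, j) \in s) || ((j, i) \in s)) in
  all (fun i => all (fun j =>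
    (i == j) || has (fun z => adj i z != adj j z) (iota 0 n))
    (iota 0 n)) (iota 0 n).

Lemma graph_of_edges_twin_free n s :
  edges_twin_free n s -> twin_free (graph_of_edges n s).
Proof.
move=> /allP chk i j tw; apply: val_inj.
have lt_iota (l : 'I_n) : val l \in iota 0 n by rewrite mem_iota ltn_ord.
have /allP/(_ _ (lt_iota j)) := chk _ (lt_iota i).
case/orP=> [/eqP // | /hasP[z]]; rewrite mem_iota /= => lt_z.
by have := tw (Ordinal lt_z); rewrite /edge /= -!val_eqE /= => ->; rewrite eqxx.
Qed.

Lemma graphA_twin_free : twin_free graphA.
Proof. exact: graph_of_edges_twin_free. Qed.

Lemma graphB_twin_free : twin_free graphB.
Proof. exact: graph_of_edges_twin_free. Qed.

Lemma graphT2_twin_free : twin_free graphT2.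
Proof. exact: graph_of_edges_twin_free. Qed.

Lemma square_not_centipede k (H : sgraph) (phi : H -> centipede k)
    (u1 u2 u3 u4 : H) :
  full_hom phi -> injective phi -> u1 != u3 -> u2 != u4 ->
  edge u1 u2 -> edge u2 u3 -> edge u3 u4 -> edge u4 u1 -> False.
Proof.
move=> hphi phi_inj d13 d24 e12 e23 e34 e41.
apply: (centipede_no_min_degree2 (S := [set u1; u2; u3; u4]) (x0 := u1)
  hphi phi_inj).
  by rewrite !inE eqxx.
move=> x; rewrite !inE -!orbA => /or4P[]/eqP->.
- by exists u2, u4; rewrite !inE !eqxx !orbT e12 edge_sym e41 d24.
- by exists u1, u3; rewrite !inE !eqxx !orbT edge_sym e12 e23 d13.
- by exists u2, u4; rewrite !inE !eqxx !orbT edge_sym e23 e34 d24.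
- by exists u1, u3; rewrite !inE !eqxx !orbT e41 edge_sym e34 d13.
Qed.

Lemma graphA_not_centipede k (phi : graphA -> centipede k) : ~ full_hom phi.
Proof.
pose u i (lt_i : i < 6) : graphA := Ordinal lt_i.
move=> hphi; have phi_inj := twin_free_full_hom_inj graphA_twin_free hphi.
exact: (@square_not_centipede _ _ phi (@u 0 isT) (@u 1 isT) (@u 2 isT) (@u 3 isT)).
Qed.

Lemma graphB_not_centipede k (phi : graphB -> centipede k) : ~ full_hom phi.
Proof.
pose u i (lt_i : i < 6) : graphB := Ordinal lt_i.
move=> hphi; have phi_inj := twin_free_full_hom_inj graphB_twin_free hphi.
exact: (@square_not_centipede _ _ phi (@u 0 isT) (@u 1 isT) (@u 2 isT) (@u 3 isT)).
Qed.

(** The centre and its three neighbours have degree at least 2, so they lie on the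
    spine, where only two positions are adjacent to that of the centre. *)
Lemma graphT2_not_centipede k (phi : graphT2 -> centipede k) : ~ full_hom phi.
Proof.
move=> hphi; have phi_inj := twin_free_full_hom_inj graphT2_twin_free hphi.
pose u i (lt_i : i < 7) : graphT2 := Ordinal lt_i.
pose c := @u 0 isT.
have spine a b : edge c a -> edge a b -> b != c -> exists i, phi a = inl i.
  move=> ca ab nbc; apply: (@branching_in_spine _ _ (phi b) (phi c)).
  - by rewrite -hphi.
  - by rewrite -hphi edge_sym.
  - by rewrite inj_eq.
have [p ep] : exists p, phi c = inl p.
  apply: (@branching_in_spine _ _ (phi (@u 1 isT)) (phi (@u 2 isT)));
    rewrite -?hphi //.
  by rewrite inj_eq.
have [q1 e1] := spine (@u 1 isT) (@u 4 isT) isT isT isT.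
have [q2 e2] := spine (@u 2 isT) (@u 5 isT) isT isT isT.
have [q3 e3] := spine (@u 3 isT) (@u 6 isT) isT isT isT.
have nbr a q : phi a = inl q -> edge c a -> q = p.+1 :> nat \/ p = q.+1 :> nat.
  by move=> eq; rewrite hphi ep eq centipede_edgeE => /orP[]/eqP; [left|right].
have neq a b q q' : phi a = inl q -> phi b = inl q' -> a != b -> q <> q' :> nat.
  by move=> ea eb /eqP nab /val_inj eq; apply/nab/phi_inj; rewrite ea eb eq.
have := (nbr _ _ e1 isT, nbr _ _ e2 isT, nbr _ _ e3 isT).
have := (neq _ _ _ _ e1 e2 isT, neq _ _ _ _ e1 e3 isT, neq _ _ _ _ e2 e3 isT).
by move=> [[n12 n13] n23] [[h1 h2] h3]; lia.
Qed.

(** * Excluding small subgraphs *)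

Lemma full_hom_graph_of (G : sgraph) n (r : rel 'I_n) (h : 'I_n -> G) :
  (forall i j : 'I_n, i < j -> edge (h i) (h j) = r i j || r j i) ->
  full_hom (h : graph_of r -> G).
Proof.
move=> hs i j; rewrite -[LHS]/((i != j) && (r i j || r j i)).
have [ij | ji | /val_inj->] := ltngtP i j.
- by rewrite hs // -val_eqE ltn_eqF.
- by rewrite edge_sym hs // orbC -val_eqE gtn_eqF.
- by rewrite eqxx edge_irr.
Qed.

(** Only adjacencies have to be checked: as [graph_of r] is twin-free, they force
    the vertices listed in [s] to be distinct. *)
Lemma has_induced_nth (G : sgraph) n (r : rel 'I_n) (x : G) (s : seq G) :
  twin_free (graph_of r) ->
  (forall i j : 'I_n, i < j -> edge (nth x s i) (nth x s j) = r i j || r j i) ->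
  has_induced G (graph_of r).
Proof.
move=> r_tf /full_hom_graph_of hs; apply/has_inducedP.
by exists (fun i : 'I_n => nth x s i) => //; apply: twin_free_full_hom_inj hs.
Qed.

Lemma has_induced_trans (G H K : sgraph) :
  has_induced G H -> has_induced H K -> has_induced G K.
Proof.
move=> /has_inducedP[f f_inj hf] /has_inducedP[g g_inj hg]; apply/has_inducedP.
by exists (f \o g); [apply: inj_comp | apply: full_hom_comp].
Qed.

Lemma no_triangle (G : sgraph) : ~ has_induced G (cycle_graph 3) ->
  forall x y z : G, edge x y -> edge y z -> edge x z = false.
Proof.
move=> noC3 x y z xy yz; apply/negbTE/negP => xz; apply: noC3.
apply: (has_induced_nth (x := x) (s := [:: x; y; z])) => [|i j].
  exact: cycle_twin_free.
case: i j => [[|[|[|i]]] lt_i] [[|[|[|j]]] lt_j] //= _.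
Qed.

Section TriangleFree.
Variable G : sgraph.
Hypothesis noC3 : ~ has_induced G (cycle_graph 3).
Let tri := no_triangle noC3.

(** The absence of triangles excludes every other adjacency among the six
    vertices, except between [v] and [w]: that pair chooses between A and B. *)
Lemma square_pendants (a b c d v w : G) :
  edge a b -> edge b c -> edge c d -> edge d a ->
  edge a v -> edge c v = false -> edge b w -> edge d w = false ->
  has_induced G graphA \/ has_induced G graphB.
Proof.
move=> ab bc cd da av cv bw dw.
have ac := tri ab bc; have bd := tri bc cd.
have [ba cb dc ad] := And4 (edgeC ab) (edgeC bc) (edgeC cd) (edgeC da).
have bv := tri ba av; have dv := tri da av.
have aw := tri ab bw; have cw := tri cb bw.
case vw: (edge v w); [right|left].
  apply: (has_induced_nth (x := a) (s := [:: a; b; c; d; v; w])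
    graphB_twin_free) => i j.
  by case: i j => [[|[|[|[|[|[|i]]]]]] lt_i] [[|[|[|[|[|[|j]]]]]] lt_j].
apply: (has_induced_nth (x := a) (s := [:: a; b; c; d; v; w])
  graphA_twin_free) => i j.
by case: i j => [[|[|[|[|[|[|i]]]]]] lt_i] [[|[|[|[|[|[|j]]]]]] lt_j].
Qed.

(** If both pairs of opposite vertices were distinct, each would be separated by
    some vertex, because [G] is twin-free.  Up to a symmetry of the 4-cycle, one
    of these is adjacent to [a] and not to [c], the other to [b] and not to
    [d]. *)
Lemma no_square (a b c d : G) :
  twin_free G -> ~ has_induced G graphA -> ~ has_induced G graphB ->
  edge a b -> edge b c -> edge c d -> edge d a -> a = c \/ b = d.
Proof.
move=> G_tf noA noB ab bc cd da.
have sep (x y : G) : x != y -> exists z, edge x z != edge y z.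
  move=> /eqP nxy; apply/existsP; rewrite -negb_forall.
  apply: contra_notN nxy => /forallP tw.
  by apply: G_tf => z; apply/eqP.
have [|nac] := eqVneq a c; first by left.
have [|nbd] := eqVneq b d; first by right.
have [v] := sep _ _ nac; have [w] := sep _ _ nbd.
have [ba cb dc ad] := And4 (edgeC ab) (edgeC bc) (edgeC cd) (edgeC da).
case bw: (edge b w); case dw: (edge d w) => // _;
  case av: (edge a v); case cv: (edge c v) => // _.
- by case: (square_pendants ab bc cd da av cv bw dw).
- by case: (square_pendants cb ba ad dc cv av bw dw).
- by case: (square_pendants ad dc cb ba av cv dw bw).
- by case: (square_pendants cd da ab bc cv av dw bw).
Qed.

(** Without triangles a closed walk of length 5 is an induced 5-cycle, since the
    vertices two steps apart on it have a common neighbour. *)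
Lemma no_pentagon (a b c d e : G) :
  ~ has_induced G (cycle_graph 5) ->
  edge a b -> edge b c -> edge c d -> edge d e -> edge e a -> False.
Proof.
move=> noC5 ab bc cd de ea; apply: noC5.
have ac := tri ab bc; have bd := tri bc cd; have ce := tri cd de.
have ad : edge a d = false by rewrite edge_sym; apply: tri de ea.
have be : edge b e = false by rewrite edge_sym; apply: tri ea ab.
have ae : edge a e by rewrite edge_sym.
apply: (has_induced_nth (x := a) (s := [:: a; b; c; d; e])) => [|i j].
  exact: cycle_twin_free.
by case: i j => [[|[|[|[|[|i]]]]] lt_i] [[|[|[|[|[|j]]]]] lt_j].
Qed.

Hypothesis sqr : forall a b c d : G,
  edge a b -> edge b c -> edge c d -> edge d a -> a = c \/ b = d.

(** If [a1], [a2], [a3] were distinct, the seven vertices would induce T_2: two of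
    the [ai] adjacent to each other, or [c] adjacent to some [bi], would give a
    triangle; [bi] adjacent to [aj], a 4-cycle; [bi] adjacent to [bj], a closed
    walk of length 5. *)
Lemma no_subdivided_claw (c a1 a2 a3 b1 b2 b3 : G) :
  ~ has_induced G (cycle_graph 5) -> ~ has_induced G graphT2 ->
  edge c a1 -> edge c a2 -> edge c a3 ->
  edge a1 b1 -> edge a2 b2 -> edge a3 b3 -> b1 != c -> b2 != c -> b3 != c ->
  [\/ a1 = a2, a1 = a3 | a2 = a3].
Proof.
move=> noC5 noT2 ca1 ca2 ca3 ab1 ab2 ab3 nb1 nb2 nb3.
have [->|/eqP n12] := eqVneq a1 a2; first by constructor 1.
have [->|/eqP n13] := eqVneq a1 a3; first by constructor 2.
have [->|/eqP n23] := eqVneq a2 a3; first by constructor 3.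
case: noT2.
have aa x y : edge c x -> edge c y -> edge x y = false.
  by move=> cx; apply: tri; rewrite edge_sym.
have ab x y b : edge c x -> edge c y -> x <> y -> edge x b -> b != c ->
    edge y b = false.
  move=> cx cy nxy xb /eqP nbc; apply/negbTE/negP => yb.
  by case: (sqr cx xb (edgeC yb) (edgeC cy)) => [cb|//]; case: nbc.
have bb x y b b' : edge c x -> edge c y -> edge x b -> edge y b' ->
    edge b b' = false.
  move=> cx cy xb yb; apply/negbTE/negP => eb.
  exact: no_pentagon noC5 cx xb eb (edgeC yb) (edgeC cy).
have [cb1 cb2 cb3] := And3 (tri ca1 ab1) (tri ca2 ab2) (tri ca3 ab3).
have [a12 a13 a23] := And3 (aa _ _ ca1 ca2) (aa _ _ ca1 ca3) (aa _ _ ca2 ca3).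
have a1b2 := ab _ _ _ ca2 ca1 (nesym n12) ab2 nb2.
have a1b3 := ab _ _ _ ca3 ca1 (nesym n13) ab3 nb3.
have a2b1 := ab _ _ _ ca1 ca2 n12 ab1 nb1.
have a2b3 := ab _ _ _ ca3 ca2 (nesym n23) ab3 nb3.
have a3b1 := ab _ _ _ ca1 ca3 n13 ab1 nb1.
have a3b2 := ab _ _ _ ca2 ca3 n23 ab2 nb2.
have b12 := bb _ _ _ _ ca1 ca2 ab1 ab2.
have b13 := bb _ _ _ _ ca1 ca3 ab1 ab3.
have b23 := bb _ _ _ _ ca2 ca3 ab2 ab3.
apply: (has_induced_nth (x := c) (s := [:: c; a1; a2; a3; b1; b2; b3])
  graphT2_twin_free) => i j.
by case: i j => [[|[|[|[|[|[|[|i]]]]]]] lt_i] [[|[|[|[|[|[|[|j]]]]]]] lt_j].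
Qed.
End TriangleFree.

Lemma no_induced_square (G : sgraph) :
  (forall a b c d : G,
     edge a b -> edge b c -> edge c d -> edge d a -> a = c \/ b = d) ->
  ~ has_induced G (cycle_graph 4).
Proof.
move=> sqr /has_inducedP[h h_inj hh].
pose u i (lt_i : i < 4) : cycle_graph 4 := Ordinal lt_i.
by case: (sqr (h (@u 0 isT)) (h (@u 1 isT)) (h (@u 2 isT)) (h (@u 3 isT)));
  rewrite -?hh // => /h_inj.
Qed.

(** * Graphs of maximum degree two without induced cycles *)

Section MaximalPath.
Variables (G : sgraph) (S : {set G}) (x0 : G).
Hypothesis acyclic : forall n, 3 <= n -> ~ has_induced G (cycle_graph n).
Hypothesis deg2 : forall x a b c, x \in S -> a \in S -> b \in S -> c \in S ->
  edge x a -> edge x b -> edge x c -> [\/ a = b, a = c | b = c].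

(** These are paths of [G] within [S], not required to be induced: inducedness
    follows from [deg2] and [acyclic]. *)
Definition path_in (s : seq G) : bool :=
  [&& uniq s, all (mem S) s & sorted edge s].

Lemma maximal_path : x0 \in S ->
  exists2 s, path_in s & 0 < size s /\ (forall t, path_in t -> size t <= size s).
Proof.
move=> x0S; pose P m := [exists t : m.-tuple G, path_in t].
have P1 : exists m, P m.
  by exists 1; apply/existsP; exists [tuple x0]; rewrite /path_in /= x0S.
have P_size t : path_in t -> P (size t).
  by move=> pt; apply/existsP; exists (in_tuple t).
have bnd m : P m -> m <= #|G|.
  case/existsP=> t /and3P[/card_uniqP eq_t _ _].
  by rewrite -(size_tuple t) -eq_t max_card.
case: (ex_maxnP P1 bnd) => m /existsP[t pt] m_max; exists t => //.
split=> [|s /P_size/m_max]; last by rewrite size_tuple.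
by rewrite size_tuple m_max // (P_size [:: x0]) // /path_in /= x0S.
Qed.

Variable s : seq G.
Hypotheses (s_path : path_in s) (s_gt0 : 0 < size s).
Hypothesis s_max : forall t, path_in t -> size t <= size s.
Let u i := nth x0 s i.

Lemma path_edge i : i.+1 < size s -> edge (u i) (u i.+1).
Proof. by case/and3P: s_path => _ _ /(sortedP x0); apply. Qed.

Lemma path_mem i : i < size s -> u i \in S.
Proof. by case/and3P: s_path => _ /allP s_S _ lt_i; apply/s_S/mem_nth. Qed.

Lemma path_nth_eq i j : i < size s -> j < size s -> (u i == u j) = (i == j).
Proof. by case/and3P: s_path => s_uniq _ _ lt_i lt_j; apply: nth_uniq. Qed.

(** The predecessor and the successor on the path are two neighbours already, and
    [deg2] leaves no room for a third one. *)
Lemma inner_nbr i y : 0 < i -> i.+1 < size s -> y \in S -> edge (u i) y ->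
  y = u i.-1 \/ y = u i.+1.
Proof.
move=> i_gt0 lt_i yS uy; have lt_i' := ltnW lt_i.
have lt_p : i.-1 < size s by lia.
have up : edge (u i) (u i.-1).
  by rewrite edge_sym -{2}(prednK i_gt0) path_edge ?prednK.
have := deg2 (path_mem lt_i') (path_mem lt_p) (path_mem lt_i) yS
  up (path_edge lt_i) uy.
case=> [/eqP|->|->]; [|by left|by right].
by rewrite path_nth_eq //; lia.
Qed.

Lemma first_nbr y : y \in S -> edge (u 0) y -> y \in s.
Proof.
move=> yS uy; apply/negPn/negP => ys.
have/s_max : path_in (y :: s); last by rewrite /= ltnn.
case/and3P: s_path => s_uniq s_S s_sorted.
rewrite /path_in /= ys s_uniq yS s_S /=.
move: s_gt0 s_sorted uy; rewrite /u; case: (s) => //= x s' _ ->.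
by rewrite edge_sym => ->.
Qed.

Lemma last_nbr y : y \in S -> edge (u (size s).-1) y -> y \in s.
Proof.
move=> yS uy; apply/negPn/negP => ys.
have/s_max : path_in (rcons s y); last by rewrite size_rcons ltnn.
case/and3P: s_path => s_uniq s_S s_sorted.
rewrite /path_in rcons_uniq all_rcons ys s_uniq inE yS s_S /=.
move: s_gt0 s_sorted uy; rewrite /u nth_last; case: (s) => //= x s' _.
by rewrite rcons_path => -> ->.
Qed.

(** No edge of [S] leaves a path of maximum size: an inner vertex has no room for
    a third neighbour, and a new neighbour of an end would extend the path. *)
Lemma path_closed x y : x \in s -> y \in S -> edge x y -> y \in s.
Proof.
move=> /(nthP x0)[i] /[swap] <- lt_i0 yS xy; have lt_i : i < size s := lt_i0.
have [i0|i_gt0] := posnP i; first by apply: first_nbr => //; rewrite -i0.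
have [lt_i1|ge_i1] := ltnP i.+1 (size s).
  have lt_p : i.-1 < size s by lia.
  by case: (inner_nbr i_gt0 lt_i1 yS xy) => ->; rewrite mem_nth.
by apply: last_nbr => //; have -> : (size s).-1 = i by lia.
Qed.

(** A chord can only join the two ends, since inner vertices have no neighbours
    but their predecessor and successor. *)
Lemma path_adj i j : i < j -> j < size s -> edge (u i) (u j) -> 
  j = i.+1 \/ i = 0 /\ j = (size s).-1.
Proof.
move=> lt_ij lt_j uij; have lt_i := ltn_trans lt_ij lt_j.
have [i0|i_gt0] := posnP i; last first.
  have lt_i1 : i.+1 < size s by lia.
  case: (inner_nbr i_gt0 lt_i1 (path_mem lt_j) uij) => /eqP.
    by rewrite path_nth_eq //; lia.
  by rewrite path_nth_eq //; lia.
have [lt_j1|ge_j1] := ltnP j.+1 (size s); last by right; lia.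
rewrite edge_sym in uij; have j_gt0 : 0 < j by lia.
case: (inner_nbr j_gt0 lt_j1 (path_mem lt_i) uij) => /eqP.
  by rewrite path_nth_eq //; lia.
by rewrite path_nth_eq //; lia.
Qed.

(** An edge between the ends would close the path into a cycle, which has no
    chord by [path_adj]. *)
Lemma path_ends : 3 <= size s -> edge (u 0) (u (size s).-1) = false.
Proof.
move=> s_ge3; apply/negbTE/negP => closing; apply: (acyclic s_ge3).
have u_inj : injective (fun i : 'I_(size s) => u i).
  by move=> i j /eqP; rewrite path_nth_eq // => /eqP/val_inj.
apply/has_inducedP; exists (fun i : 'I_(size s) => u i) => //.
apply: full_hom_graph_of => i j lt_ij; have lt_j := ltn_ord j.
apply/idP/idP => [/(path_adj lt_ij lt_j)|].
  case=> [eq_j | [eq_i eq_j]]; apply/orP.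
    by left; rewrite /= eq_j modn_small // -eq_j.
  by right; rewrite /= eq_i eq_j prednK // modnn.
have lt_i1 : i.+1 < size s by lia.
rewrite (modn_small lt_i1) => /orP[/eqP -> | ]; first exact: path_edge.
have [lt_j1 | ge_j1] := ltnP j.+1 (size s).
  by rewrite modn_small // => /eqP /= eq_i; lia.
have -> : j.+1 = size s by lia.
rewrite modnn => /eqP ->; rewrite (_ : val j = (size s).-1) //.
by move=> /=; lia.
Qed.

Lemma path_induced i j : i < size s -> j < size s ->
  edge (u i) (u j) = (j == i.+1) || (i == j.+1).
Proof.
have lt_case k l : k < l -> l < size s ->
    edge (u k) (u l) = (l == k.+1) || (k == l.+1).
  move=> lt_kl lt_l; apply/idP/idP => [|/orP[]/eqP eq]; last by lia.
    move=> e; case: (path_adj lt_kl lt_l e) => [->|[k0 el]]; first by rewrite eqxx.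
    have [s_ge3|] := leqP 3 (size s); last by lia.
    by rewrite k0 el path_ends in e.
  by rewrite eq in lt_l *; apply: path_edge.
have [ij lt_i lt_j | ji lt_i lt_j | -> _ _] := ltngtP i j.
- exact: lt_case.
- by rewrite edge_sym lt_case // orbC.
- by rewrite edge_irr; apply/esym/negbTE; lia.
Qed.
End MaximalPath.

(** A path of maximum size in [S] is induced and joined by no edge to the rest of
    [S].  It is laid out first; the rest of [S], laid out by induction, follows
    after one unused position that keeps the two parts non-adjacent. *)
Lemma linear_forest (G : sgraph) (S : {set G}) :
  (forall n, 3 <= n -> ~ has_induced G (cycle_graph n)) ->
  (forall x a b c, x \in S -> a \in S -> b \in S -> c \in S ->
    edge x a -> edge x b -> edge x c -> [\/ a = b, a = c | b = c]) ->
  exists2 f : G -> nat, {in S &, injective f} &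
    {in S &, forall x y, edge x y = (f y == (f x).+1) || (f x == (f y).+1)}.
Proof.
move=> acyclic; have [n le_n] := ubnP #|S|.
elim: n S le_n => // n IHn S; rewrite ltnS => le_n deg2.
have [->|[x0 x0S]] := set_0Vmem S.
  by exists (fun=> 0) => x y; rewrite inE.
have [s s_path [s_gt0 s_max]] := maximal_path x0S.
have /and3P[s_uniq /allP s_S _] := s_path.
pose S' := S :\: [set x in s].
have S'S : {subset S' <= S} by move=> x /setDP[].
have [||f f_inj f_edge] := IHn S'.
- apply: leq_trans le_n; apply/proper_card/properP; split; first exact/subsetP.
  exists (nth x0 s 0); first by apply: s_S; rewrite mem_nth.
  by rewrite !inE mem_nth.
- by move=> x a b c /S'S xS /S'S aS /S'S bS /S'S cS; apply: deg2.
pose g x := if x \in s then index x s else (size s).+1 + f x.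
have inS' x : x \in S -> x \notin s -> x \in S' by rewrite !inE => -> ->.
have sep x y : x \in s -> y \in S -> y \notin s -> edge x y = false.
  move=> xs yS; apply: contraNF => xy.
  exact: (path_closed x0 deg2 s_path s_gt0 s_max xs yS xy).
have lt_index z : z \in s -> index z s < size s by rewrite index_mem.
exists g => x y xS yS; rewrite /g.
all: have [xs|xs] := boolP (x \in s); have [ys|ys] := boolP (y \in s).
- exact: index_inj.
- by have := lt_index x xs; lia.
- by have := lt_index y ys; lia.
- by move/addnI; apply: f_inj; apply: inS'.
- have := path_induced x0 acyclic deg2 s_path s_gt0 (lt_index x xs) (lt_index y ys).
  by rewrite !nth_index.
- by rewrite sep //; have := lt_index x xs; lia.
- by rewrite edge_sym sep //; have := lt_index y ys; lia.
- by rewrite f_edge ?inS' // -!addnS !eqn_add2l.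
Qed.

(** * Colouring a graph without induced cycles *)

Section Colouring.
Variable G : sgraph.
Hypothesis acyclic : forall n, 3 <= n -> ~ has_induced G (cycle_graph n).
Hypothesis noT2 : ~ has_induced G graphT2.
Hypothesis sqr : forall a b c d : G,
  edge a b -> edge b c -> edge c d -> edge d a -> a = c \/ b = d.

Definition branching (x : G) : bool :=
  [exists a, exists b, [&& a != b, edge x a & edge x b]].

(** The second alternative concerns the components with two vertices, in which
    the numbering of the vertices of [G] selects one of the two ends. *)
Definition spine : {set G} :=
  [set x | branching x || [exists y,
    [&& edge x y, ~~ branching y & enum_rank x < enum_rank y]]].

Lemma branchingP x :
  reflect (exists a b, [/\ a != b, edge x a & edge x b]) (branching x).
Proof.
apply: (iffP existsP) => [[a /existsP[b /and3P[]]] | [a [b [ab xa xb]]]].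
  by exists a, b.
by exists a; apply/existsP; exists b; rewrite ab xa.
Qed.

Lemma unbranching_nbr x a b : ~~ branching x -> edge x a -> edge x b -> a = b.
Proof.
move=> nx xa xb; apply/eqP; apply: contraNT nx => nab.
by apply/branchingP; exists a, b.
Qed.

Lemma branching_nbr x y : branching x -> y \in spine -> edge x y -> branching y.
Proof.
move=> x_br; rewrite inE => /orP[// | /existsP[z /and3P[yz z_nbr _]]] xy.
apply: contraNT z_nbr => y_nbr.
by rewrite (unbranching_nbr y_nbr yz (_ : edge y x)) // edge_sym.
Qed.

(** A neighbour in the spine of a branching vertex [x] is branching, so it has a
    neighbour other than [x]; three of them would give T_2. *)
Lemma spine_deg2 x a b c :
  x \in spine -> a \in spine -> b \in spine -> c \in spine ->
  edge x a -> edge x b -> edge x c -> [\/ a = b, a = c | b = c].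
Proof.
move=> _ aS bS cS xa xb xc.
have [x_br|x_nbr] := boolP (branching x); last first.
  by constructor 1; apply: unbranching_nbr x_nbr xa xb.
have beyond y : y \in spine -> edge x y -> exists2 z, edge y z & z != x.
  move=> yS xy; have /branchingP[z [t [nzt yz yt]]] := branching_nbr x_br yS xy.
  have [zx|nzx] := eqVneq z x; last by exists z.
  by exists t => //; rewrite -zx eq_sym.
have [a' aa' na'] := beyond a aS xa; have [b' bb' nb'] := beyond b bS xb.
have [c' cc' nc'] := beyond c cS xc.
apply: (no_subdivided_claw _ sqr _ noT2 xa xb xc aa' bb' cc' na' nb' nc');
  exact: acyclic.
Qed.

Lemma off_spine_nbr x y : x \notin spine -> edge x y -> y \in spine.
Proof.
move=> xS xy; apply: contraNT (xS) => yS.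
have [nx ny] : ~~ branching x /\ ~~ branching y.
  by move: xS yS; rewrite !inE !negb_or => /andP[-> _] /andP[-> _].
have nxy : enum_rank x != enum_rank y by rewrite (inj_eq enum_rank_inj) edge_neq.
have [lt_xy|lt_yx|/val_inj exy] := ltngtP (enum_rank x) (enum_rank y).
- by rewrite inE; apply/orP; right; apply/existsP; exists y; rewrite xy ny.
- case/negP: yS; rewrite inE; apply/orP; right; apply/existsP; exists x.
  by rewrite edge_sym xy nx.
- by rewrite exy eqxx in nxy.
Qed.

(** Vertices outside the spine with a common neighbour share a leaf, and the
    isolated ones share the leaf [ord_max], at a position that [f] does not
    reach. *)
Lemma centipede_colouring : exists2 k, 1 <= k &
  exists phi : G -> centipede k, full_hom phi.
Proof.
have [f f_inj f_edge] := linear_forest acyclic spine_deg2.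
pose N := (\max_(x : G) f x).+1.
have lt_f x : f x < N by rewrite ltnS; apply: leq_bigmax.
pose q x : 'I_N.+1 := inord (f x).
have val_q x : q x = f x :> nat by rewrite inordK // ltnS ltnW.
pose phi x : centipede N.+1 := if x \in spine then inl (q x)
  else if [pick y | edge x y] is Some y then inr (q y) else inr ord_max.
exists N.+1 => //; exists phi.
have mixed x y : x \in spine -> y \notin spine -> edge x y = edge (phi x) (phi y).
  move=> xS yS; rewrite centipede_edgeE /phi xS (negbTE yS).
  case: pickP => [z yz|y_iso]; last first.
    by rewrite edge_sym y_iso -val_eqE /= val_q ltn_eqF.
  have zS := off_spine_nbr yS yz.
  rewrite -val_eqE /= !val_q (inj_in_eq f_inj) //.
  apply/idP/eqP => [xy | ->]; last by rewrite edge_sym.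
  have y_nbr : ~~ branching y by move: yS; rewrite inE negb_or => /andP[].
  by apply: (unbranching_nbr y_nbr) => //; rewrite edge_sym.
move=> x y; have [xS|xS] := boolP (x \in spine);
  have [yS|yS] := boolP (y \in spine).
- by rewrite centipede_edgeE /phi xS yS f_edge //= !val_q.
- exact: mixed.
- by rewrite edge_sym mixed // edge_sym.
- have off z : z \notin spine -> exists i, phi z = inr i.
    move=> zS; rewrite /phi (negbTE zS).
    by case: pickP => [t _|_]; eexists.
  have [i ->] := off x xS; have [j ->] := off y yS; rewrite centipede_edgeE.
  by apply: contraNF yS => /(off_spine_nbr xS).
Qed.
End Colouring.

(** * Reduction to twin-free graphs *)

(** [pick] depends only on the extension of its predicate, so twins get the same
    representative; this is [twin_rep_eq]. *)
Definition twin_rep (G : sgraph) (x : G) : G :=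
  odflt x [pick y | [forall z, edge x z == edge y z]].

Lemma twin_repP (G : sgraph) (x z : G) : edge (twin_rep x) z = edge x z.
Proof.
by rewrite /twin_rep; case: pickP => [y /forallP/(_ z)/eqP|] //=.
Qed.

Lemma twin_rep_eq (G : sgraph) (x y : G) :
  (forall z, edge x z = edge y z) -> twin_rep x = twin_rep y.
Proof.
move=> tw; rewrite /twin_rep.
have eq_p : [pred t | [forall z, edge x z == edge t z]] =1
            [pred t | [forall z, edge y z == edge t z]].
  by move=> t /=; apply: eq_forallb => z; rewrite tw.
rewrite (eq_pick eq_p); case: pickP => // /(_ y) /=.
by move/negbT/negP; case; apply/forallP.
Qed.

Definition twin_quotient (G : sgraph) : sgraph := induced [set twin_rep x | x in G].

Lemma twin_quotient_free (G : sgraph) : twin_free (twin_quotient G).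
Proof.
move=> x y tw; apply: val_inj.
have rep_id (t : twin_quotient G) : twin_rep (val t) = val t.
  by have /imsetP[s _ ->] := valP t; apply: twin_rep_eq => z; rewrite twin_repP.
rewrite -(rep_id x) -(rep_id y); apply: twin_rep_eq => z.
have rz : twin_rep z \in [set twin_rep x | x in G] by apply: imset_f.
have := tw (exist _ (twin_rep z) rz).
by rewrite /edge /= ![edge _ (twin_rep z)]edge_sym !twin_repP ![edge z _]edge_sym.
Qed.

Lemma twin_quotient_colouring (G : sgraph) :
  exists phi : G -> twin_quotient G, full_hom phi.
Proof.
have rx x : twin_rep x \in [set twin_rep x | x in G] by apply: imset_f.
exists (fun x => Sub (twin_rep x) (rx x)) => x y.
by rewrite /edge /= twin_repP edge_sym twin_repP edge_sym.
Qed.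

Lemma induced_has_induced (G : sgraph) (S : {set G}) : has_induced G (induced S).
Proof. by apply/has_inducedP; exists val => //; apply: val_inj. Qed.

Theorem corollary18 (G : sgraph) :
  full_colourable is_centipede G <->
  [/\ forall n : nat, 3 <= n -> n <> 4 -> ~ has_induced G (cycle_graph n),
      ~ has_induced G graphA,
      ~ has_induced G graphB
    & ~ has_induced G graphT2].
Proof.
split=> [/centipede_colourableP[k _ [phi hphi]] | [noC noA noB noT2]].
  have exclude (H : sgraph) :
      (forall psi : H -> centipede k, ~ full_hom psi) -> ~ has_induced G H.
    move=> noH /has_inducedP[h _ hh].
    by apply: (noH (phi \o h)); apply: full_hom_comp.
  split; [move=> n n_gt2 n_neq4|..]; apply: exclude => psi.
  - exact: cycle_not_centipede.
  - exact: graphA_not_centipede.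
  - exact: graphB_not_centipede.
  - exact: graphT2_not_centipede.
set Q := twin_quotient G.
have [pi hpi] : exists phi : G -> Q, full_hom phi by exact: twin_quotient_colouring.
have inherit (H : sgraph) : ~ has_induced G H -> ~ has_induced Q H.
  by move=> noH QH; apply/noH/(has_induced_trans (induced_has_induced _) QH).
have noC3 : ~ has_induced Q (cycle_graph 3) by apply/inherit/noC.
have sqr (a b c d : Q) := @no_square _ noC3 a b c d (@twin_quotient_free G)
  (inherit _ noA) (inherit _ noB).
have acyclic n : 3 <= n -> ~ has_induced Q (cycle_graph n).
  move=> n_gt2; have [->|/eqP n_neq4] := eqVneq n 4; first exact: no_induced_square.
  exact/inherit/noC.
have [k k_gt0 [phi hphi]] := centipede_colouring acyclic (inherit _ noT2) sqr.
apply/centipede_colourableP; exists k => //.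
by exists (phi \o pi); apply: full_hom_comp.
Qed.
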